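(* Let $0<\varepsilon<1$. The approximations $\breve A_k(\mathbf n)$ and $\breve v_k(\mathbf n)$ ($k\in\mathcal K$) produced by the truncated algorithm described in the context satisfy, for every $k\in\mathcal K$, $$\sum_{\mathbf n\in\mathcal Z,\ |\mathbf n|\le n_A(k)}\breve A_k(\mathbf n)\,e>(1-\varepsilon)\,e\quad\text{(entrywise)},\qquad \sum_{\mathbf n\in\mathcal Z,\ |\mathbf n|\le n_v(k)}\breve v_k(\mathbf n)\,e>(1-\varepsilon)\,\lambda_k^{(\mathrm B)}.$$
   Context: Model. Let $K,M\ge 1$, $\mathcal K=\{1,\dots,K\}$, $\mathcal M=\{1,\dots,M\}$. Arrivals to a queue are governed by an irreducible continuous-time Markov chain (the underlying Markov chain) on $\mathcal M$. The chain stays in state $i$ for an exponential time with mean $\mu_i^{-1}$; then with probability $\sigma_{i,j}(0)$ ($j\ne i$) it moves to $j$ without arrivals, and with probability $\sigma_{k,i,j}(n)$ ($k\in\mathcal K$, $n\ge1$, $j\in\mathcal M$) it moves to $j$ and a batch of $n$ class $k$ customers arrives simultaneously. Put $\sigma_{i,i}(0)=0$; these probabilities sum to $1$ for each $i$. Define $M\times M$ matrices $C$ by $C_{i,i}=-\mu_i$, $C_{i,j}=\sigma_{i,j}(0)\mu_i$ ($i\neq j$), and $D_k(n)$ by $[D_k(n)]_{i,j}=\sigma_{k,i,j}(n)\mu_i$; $D_k=\sum_{n\ge1}D_k(n)$, $D=\sum_{k}D_k$. Let $e$ be an all-ones column vector and $\pi$ the unique stationary probability row vector with $\pi(C+D)=0$,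 $\pi e=1$. Let $\lambda_k=\sum_{n\ge1}n\,\pi D_k(n)e$ (finite) and $\lambda_k^{(\mathrm B)}=\pi D_ke$. Each $D_k$ has at least one positive entry. Service times of class $k$ customers are i.i.d. with distribution function $H_k$ on $[0,\infty)$ with finite mean $h_k>0$, independent of everything else. Customers are served by a single work-conserving FIFO server. Assume $\rho=\sum_k\lambda_kh_k<1$ and steady state. Batch sizes are phase-type: $D_k(n)=g_k(n)D_k$ with $g_k(n)=\alpha_kP_k^{n-1}(I-P_k)e$, $\alpha_k$ a probability vector and $P_k$ a substochastic matrix with $I-P_k$ nonsingular. Let $V$ be the stationary amount of work in system, $S$ the stationary state of the underlying chain, $v(x)$ the $1\times M$ vector with $j$th entry $\Pr[V\le x,S=j]$, $v^*(s)$ its Laplace–Stieltjes transform, and $\overline v^{(1)}=-\lim_{s\to0+}dv^*(s)/ds$ (assumed finite). Let $\theta=\max_i|C_{i,i}|$ and, for $m\ge0$, $$\gamma_k^{(m)}(\theta)=\int_0^\infty e^{-\theta y}\frac{(\theta y)^m}{m!}dH_k(y),\qquad v^{(m)}(\theta)=\int_0^\infty e^{-\theta x}\frac{(\theta x)^m}{m!}dv(x)$$ (integrals include atoms at $0$). $\mathcal Z$ is the set of $K$-vectors of nonnegative integers, $|\mathbf n|=\sum_kn_k$, $\mathbf e_k$ is the $k$th unit vector, and $U(x)=1$ if $x\ge0$, $U(x)=0$ if $x<0$. Vector inequalities are entrywise. Algorithm, given $0<\varepsilon<1$. Step 1: choose $0<\varepsilon_F<1$ with $\dfrac{\varepsilon_F}{\varepsilon}<\min_{k\in\mathcal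 K}\min\Big(\dfrac1{\theta h_k},\dfrac{\lambda_k^{(\mathrm B)}}{\theta\,\overline v^{(1)}D_ke}\Big)$, and integers $m_\gamma(k),m_v(k)\ge0$ ($k\in\mathcal K$) such that $\sum_{m=0}^{m_\gamma(k)}\gamma_k^{(m)}(\theta)(1-\varepsilon_F)^m>1-\varepsilon$ and $\sum_{m=0}^{m_v(k)}v^{(m)}(\theta)D_ke\,(1-\varepsilon_F)^m>(1-\varepsilon)\lambda_k^{(\mathrm B)}$. Put $m_{\max}=\max_{k}\max(m_\gamma(k),m_v(k))$. Step 2: choose $0<\varepsilon_g<\varepsilon_F$ and integers $n_g(k)\ge 1$ with $\theta^{-1}\sum_{n=1}^{n_g(k)}g_k(n)D_ke>\theta^{-1}D_ke-\frac{\varepsilon_g}{K}e$ for all $k\in\mathcal K$. Step 3: put $n_F^{(0)}=0$, $\breve F_0(\mathbf 0)=I$; $n_F^{(1)}=\max_kn_g(k)$, $\breve F_1(\mathbf 0)=I+\theta^{-1}C$, $\breve F_1(n\mathbf e_k)=\theta^{-1}g_k(n)D_k$ for $k\in\mathcal K$, $1\le n\le n_g(k)$, and $\breve F_1(\mathbf n)=O$ for all other $\mathbf n$. For $m=2,\dots,m_{\max}$ successively, define for $\mathbf n\in\mathcal Z$ $$\breve F_m(\mathbf n)=U(n_F^{(m-1)}-|\mathbf n|)\breve F_{m-1}(\mathbf n)(I+\theta^{-1}C)+\theta^{-1}\sum_{k\in\mathcal K}\sum_{l_k=1}^{\min(n_k,n_g(k))}U(n_F^{(m-1)}-|\mathbf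 n-l_k\mathbf e_k|)\,\breve F_{m-1}(\mathbf n-l_k\mathbf e_k)g_k(l_k)D_k,$$ and let $n_F^{(m)}$ be the first integer $n^*\geq 0$ (searching $n^*=0,1,\dots$) with $\sum_{|\mathbf n|\le n^*}\breve F_m(\mathbf n)e>(1-\varepsilon_F)^me$. Output: $$\breve A_k(\mathbf n)=\sum_{m=0}^{m_\gamma(k)}U(n_F^{(m)}-|\mathbf n|)\gamma_k^{(m)}(\theta)\breve F_m(\mathbf n),\qquad \breve v_k(\mathbf n)=\sum_{m=0}^{m_v(k)}U(n_F^{(m)}-|\mathbf n|)v^{(m)}(\theta)D_k\breve F_m(\mathbf n),$$ with $n_A(k)=\max\{n_F^{(m)}:0\le m\le m_\gamma(k)\}$ and $n_v(k)=\max\{n_F^{(m)}:0\le m\le m_v(k)\}$. *)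

(* Defs.v *)
From HB Require Import structures.
From mathcomp Require Import all_boot all_order all_algebra.
From mathcomp Require Import all_classical all_reals all_analysis.

Set Implicit Arguments.
Unset Strict Implicit.
Unset Printing Implicit Defensive.

Import Order.TTheory GRing.Theory Num.Theory.
Import numFieldNormedType.Exports.

Local Open Scope classical_set_scope.
Local Open Scope ring_scope.

(* [sigma k i j n] and [gB] below are meaningful for n >= 1 only; every use
   is restricted to such n. *)
Record queue (R : realType) (K M : nat) := Queue {
  mu : 'I_M -> R;
  sigma0 : 'I_M -> 'I_M -> R;
  sigma : 'I_K -> 'I_M -> 'I_M -> nat -> R;
  phases : 'I_K -> nat;
  alpha : forall k, 'rV[R]_(phases k);
  phP : forall k, 'M[R]_(phases k);
  service_law : 'I_K -> probability (measurableTypeR R) R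
}.

Section Queue.
Context (R : realType) (K M : nat) (q : queue R K M).

Definition ones {n : nat} : 'cV[R]_n := const_mx 1.

Definition mxlt (m n : nat) (A B : 'M[R]_(m, n)) : bool :=
  [forall i, [forall j, A i j < B i j]].

Definition matC : 'M[R]_M :=
  \matrix_(i, j) if i == j then - mu q i else sigma0 q i j * mu q i.

Definition matDn (k : 'I_K) (n : nat) : 'M[R]_M :=
  \matrix_(i, j) (sigma q k i j n * mu q i).

Definition matD (k : 'I_K) : 'M[R]_M :=
  \matrix_(i, j) fine (\sum_(1 <= n <oo) (matDn k n i j)%:E)%E.

Definition matDtot : 'M[R]_M := \sum_k matD k.

Definition gB (k : 'I_K) (n : nat) : R :=
  (alpha q k *m (phP q k ^+ n.-1) *m (1%:M - phP q k) *m ones) 0 0.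

Definition mean_service (k : 'I_K) : R :=
  (\int[service_law q k]_(x in `[0%R, +oo[) x)%R.

Definition is_stationary (pi : 'rV[R]_M) : Prop :=
  [/\ forall i, 0 <= pi 0 i,
      pi *m (matC + matDtot) = 0
    & (pi *m ones) 0 0 = 1].

Definition lambda_ereal (pi : 'rV[R]_M) (k : 'I_K) : \bar R :=
  (\sum_(1 <= n <oo) (n%:R * (pi *m matDn k n *m ones) 0 0)%:E)%E.

Definition lambda (pi : 'rV[R]_M) (k : 'I_K) : R := fine (lambda_ereal pi k).

Definition lambdaB (pi : 'rV[R]_M) (k : 'I_K) : R :=
  (pi *m matD k *m ones) 0 0.

Definition rho (pi : 'rV[R]_M) : R :=
  \sum_k lambda pi k * mean_service k.

Record queue_assumptions (pi : 'rV[R]_M) : Prop := {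
  mu_gt0 : forall i, 0 < mu q i;
  sigma0_ge0 : forall i j, 0 <= sigma0 q i j;
  sigma0_diag : forall i, sigma0 q i i = 0;
  sigma_ge0 : forall k i j n, (1 <= n)%N -> 0 <= sigma q k i j n;
  sigma_total : forall i,
    (\sum_j (sigma0 q i j)%:E
     + \sum_k \sum_j \sum_(1 <= n <oo) (sigma q k i j n)%:E = 1)%E;
  irreducible_chain : forall i j,
    connect (fun a b => 0 < (matC + matDtot) a b) i j;
  pi_stationary : is_stationary pi;
  lambda_fin : forall k, (lambda_ereal pi k < +oo)%E;
  D_pos_entry : forall k, exists i j, 0 < matD k i j;
  service_law_support : forall k, service_law q k `[0%R, +oo[%classic = 1%E;
  service_mean_fin : forall k,
    (service_law q k).-integrable `[0%R, +oo[%classic (fun x : measurableTypeR R => (x : R)%:E);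
  mean_service_gt0 : forall k, 0 < mean_service k;
  rho_lt1 : rho pi < 1;
  alpha_ge0 : forall k i, 0 <= alpha q k 0 i;
  alpha_total : forall k, (alpha q k *m ones) 0 0 = 1;
  phP_ge0 : forall k i j, 0 <= phP q k i j;
  phP_substoch : forall k i, (phP q k *m ones) i 0 <= 1;
  phP_unit : forall k, 1%:M - phP q k \in unitmx;
  batch_phase_type : forall k n, (1 <= n)%N -> matDn k n = gB k n *: matD k
}.

Definition transition_prob (i : 'I_M) (a : option ('I_K * nat)) (j : 'I_M) : R :=
  match a with
  | None => sigma0 q i j
  | Some (k, n) => if (1 <= n)%N then sigma q k i j n else 0
  end.

End Queue.

(* The randomness driving the queue on the time axis [0, +oo):
   [init_work] is the work in system at time 0; [chain m] is the state of the underlying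
   chain just before its [m]-th transition (so [chain 0] is the state at time 0)
   and [sojourn m] the time it stays there; [event m] is [None] if the [m]-th transition
   brings no arrivals and [Some (k, n)] if it brings a batch of n class k
   customers; [service k m l] is the service time of the [l]-th of these customers
   (it is only used when the batch is of class k). *)
Record driving (R : realType) (K M : nat) (Omega : Type) := Driving {
  init_work : Omega -> R;
  chain : nat -> Omega -> 'I_M;
  sojourn : nat -> Omega -> R;
  event : nat -> Omega -> option ('I_K * nat);
  service : 'I_K -> nat -> nat -> Omega -> R
}.

Section Workload.
Context (R : realType) (K M : nat) (q : queue R K M).
Context (d : measure_display) (Omega : measurableType d)
        (P : probability Omega R) (w : driving R K M Omega).

(* Given ([init_work], [chain 0]), the underlying chain runs with the prescribed rates and
   the service times are mutually independent, [service k m l] having distribution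
   [service_law k], and independent of everything else: the finite-dimensional
   distributions have the expected product form. *)
Record driving_law : Prop := {
  init_work_ge0 : forall o, 0 <= init_work w o;
  init_work_measurable : measurable_fun setT (init_work w : Omega -> measurableTypeR R);
  sojourn_measurable : forall m,
    measurable_fun setT (sojourn w m : Omega -> measurableTypeR R);
  service_measurable : forall k m l,
    measurable_fun setT (service w k m l : Omega -> measurableTypeR R);
  chain_measurable : forall m i, measurable (chain w m @^-1` [set i]);
  event_measurable : forall m a, measurable (event w m @^-1` [set a]);
  driving_fdd : forall (A : set (measurableTypeR R)) (n L : nat)
      (i : nat -> 'I_M) (t : nat -> R) (a : nat -> option ('I_K * nat))
      (b : 'I_K -> nat -> nat -> R),
    measurable A -> (forall m, 0 <= t m) ->
    P [set o | [/\ A (init_work w o), chain w 0 o = i 0%N,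
          forall m, (m < n)%N ->
            [/\ t m < sojourn w m o, event w m o = a m & chain w m.+1 o = i m.+1]
        & forall k m l, (m < n)%N -> (l < L)%N -> service w k m l o <= b k m l]]
    = (P [set o | A (init_work w o) /\ chain w 0 o = i 0%N]
       * (\prod_(m < n) (expR (- (mu q (i m) * t m))
                         * transition_prob q (i m) (a m) (i m.+1)))%:E
       * (\prod_k \prod_(m < n) \prod_(l < L)
            fine (service_law q k `]-oo, b k m l]%classic))%:E)%E
}.

Definition epoch (n : nat) (o : Omega) : R := \sum_(m < n) sojourn w m o.

Definition batch_work (n : nat) (o : Omega) : R :=
  match event w n o with
  | None => 0
  | Some (k, size) => \sum_(l < size) service w k n l o
  end.

(* Work in system right after the [n]-th epoch. The server works at unit rate
   whenever there is work, so the work in system does not depend on the order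
   in which customers are served. *)
Fixpoint work_at_epoch (n : nat) (o : Omega) : R :=
  match n with
  | 0 => init_work w o
  | m.+1 => Num.max (work_at_epoch m o - sojourn w m o) 0 + batch_work m o
  end.

(* The event that at time t the work in system is in A and the underlying
   chain is in state j. Under [driving_law] the index n of the last epoch
   before t exists and is unique almost surely. *)
Definition state_at (t : R) (A : set R) (j : 'I_M) : set Omega :=
  [set o | exists n,
     [/\ epoch n o <= t < epoch n.+1 o, chain w n o = j
       & A (Num.max (work_at_epoch n o - (t - epoch n o)) 0)]].

(* The joint law of work in system and chain state is [v] at every time:
   [v j A] = Pr[V in A, S = j]. *)
Definition stationary_law
    (v : 'I_M -> {finite_measure set (measurableTypeR R) -> \bar R}) : Prop :=
  (forall (j : 'I_M) (A : set (measurableTypeR R)), measurable A ->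
     P [set o | A (init_work w o) /\ chain w 0 o = j] = v j A) /\
  (forall (t : R) (j : 'I_M) (A : set (measurableTypeR R)),
     0 <= t -> measurable A -> P (state_at t A j) = v j A).

End Workload.

Section Transforms.
Context (R : realType) (K M : nat) (q : queue R K M).
Context (v : 'I_M -> {finite_measure set (measurableTypeR R) -> \bar R}).

Definition vstar (j : 'I_M) (s : R) : R :=
  (\int[v j]_(x in `[0%R, +oo[) expR (- (s * x)))%R.

Definition vbar1_finite : Prop :=
  forall j, cvg (derive1 (vstar j) x @[x --> 0^'+]).

Definition vbar1 : 'rV[R]_M :=
  \row_j (- lim (derive1 (vstar j) x @[x --> 0^'+])).

Definition theta : R := \big[Num.max/0]_(i < M) `|matC q i i|.

Definition poisson_weight (m : nat) (x : R) : R :=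
  expR (- (theta * x)) * ((theta * x) ^+ m / m`!%:R).

Definition gammam (k : 'I_K) (m : nat) : R :=
  (\int[service_law q k]_(y in `[0%R, +oo[) poisson_weight m y)%R.

Definition vm (m : nat) : 'rV[R]_M :=
  \row_j (\int[v j]_(x in `[0%R, +oo[) poisson_weight m x)%R.

End Transforms.

Section MultiIndex.
Context (K : nat).

Definition multi := {ffun 'I_K -> nat}.

Definition mabs (n : multi) : nat := (\sum_k n k)%N.

Definition multi0 : multi := [ffun=> 0%N].

Definition munit (k : 'I_K) (l : nat) : multi :=
  [ffun j => if j == k then l else 0%N].

Definition msub (n n' : multi) : multi := [ffun j => (n j - n' j)%N].

(* The sum of F n over all n with |n| <= N; components of such n are at most
   N, so they are enumerated by a finite type. *)
Definition multi_sum (R : realType) (p r : nat) (N : nat)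
    (F : multi -> 'M[R]_(p, r)) : 'M[R]_(p, r) :=
  \sum_(f : {ffun 'I_K -> 'I_N.+1} | (\sum_k f k <= N)%N)
    F [ffun k => f k : nat].

End MultiIndex.

(* The junk value 0 is used when the search does not terminate. *)
Definition first_nat (Q : pred nat) : nat :=
  if pselect (exists n, Q n) is left exQ then ex_minn exQ else 0%N.

Definition ustep (R : realType) (x : int) : R := if 0 <= x then 1 else 0.

Record choices (R : realType) (K : nat) := Choices {
  epsF : R;
  mgamma : 'I_K -> nat;
  mv : 'I_K -> nat;
  epsg : R;
  ng : 'I_K -> nat
}.

Section Algorithm.
Context (R : realType) (K M : nat) (q : queue R K M) (pi : 'rV[R]_M).
Context (v : 'I_M -> {finite_measure set (measurableTypeR R) -> \bar R}).
Context (eps : R) (c : choices R K).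

Local Notation th := (theta q).

Definition step1 : Prop :=
  [/\ 0 < epsF c < 1,
      forall k, epsF c / eps <
        Num.min (1 / (th * mean_service q k))
                (lambdaB q pi k
                 / (th * (vbar1 v *m matD q k *m ones R) 0 0)),
      forall k, 1 - eps <
        \sum_(0 <= m < (mgamma c k).+1) gammam q k m * (1 - epsF c) ^+ m
    & forall k, (1 - eps) * lambdaB q pi k <
        \sum_(0 <= m < (mv c k).+1)
          (vm q v m *m matD q k *m ones R) 0 0 * (1 - epsF c) ^+ m].

Definition step2 : Prop :=
  [/\ 0 < epsg c < epsF c,
      forall k, (1 <= ng c k)%N
    & forall k,
        mxlt (th^-1 *: (matD q k *m ones R) - (epsg c / K%:R) *: ones R)
             (th^-1 *: \sum_(1 <= n < (ng c k).+1)
                          (gB q k n *: matD q k *m ones R))].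

Definition F0 (n : multi K) : 'M[R]_M := if n == multi0 K then 1%:M else 0.

Definition F1 (n : multi K) : 'M[R]_M :=
  if n == multi0 K then 1%:M + th^-1 *: matC q
  else if [pick k | (n == munit k (n k)) && (n k <= ng c k)%N] is Some k
  then th^-1 *: (gB q k (n k) *: matD q k)
  else 0.

Definition Fstep (N : nat) (F : multi K -> 'M[R]_M) (n : multi K) : 'M[R]_M :=
  ustep R (N%:Z - (mabs n)%:Z) *: (F n *m (1%:M + th^-1 *: matC q))
  + th^-1 *: \sum_k \sum_(1 <= l < (minn (n k) (ng c k)).+1)
      ustep R (N%:Z - (mabs (msub n (munit k l)))%:Z)
        *: (F (msub n (munit k l)) *m (gB q k l *: matD q k)).

(* The pair of n_F^(m) and F_m. *)
Fixpoint algo (m : nat) : nat * (multi K -> 'M[R]_M) :=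
  match m with
  | 0 => (0%N, F0)
  | m'.+1 =>
      if m' == 0%N then ((\max_k ng c k)%N, F1) else
      let F := Fstep (algo m').1 (algo m').2 in
      (first_nat (fun N =>
         mxlt ((1 - epsF c) ^+ m *: ones R)
              (multi_sum N (fun n => F n *m ones R))), F)
  end.

Definition nF (m : nat) : nat := (algo m).1.
Definition Fbreve (m : nat) : multi K -> 'M[R]_M := (algo m).2.

Definition Abreve (k : 'I_K) (n : multi K) : 'M[R]_M :=
  \sum_(0 <= m < (mgamma c k).+1)
    (ustep R ((nF m)%:Z - (mabs n)%:Z) * gammam q k m) *: Fbreve m n.

Definition vbreve (k : 'I_K) (n : multi K) : 'rV[R]_M :=
  \sum_(0 <= m < (mv c k).+1)
    ustep R ((nF m)%:Z - (mabs n)%:Z) *: (vm q v m *m matD q k *m Fbreve m n).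

Definition nA (k : 'I_K) : nat := (\max_(0 <= m < (mgamma c k).+1) nF m)%N.
Definition nv (k : 'I_K) : nat := (\max_(0 <= m < (mv c k).+1) nF m)%N.

End Algorithm.

(* Main.v *)
(** Each truncated convolution step multiplies the total mass
[sum_(|n| <= n_F) F_m(n)] on the right by one fixed matrix T. Since (C + D) e = 0,
step 2 gives T e >= (1 - epsg) e, and epsg < epsF, so an induction on m shows both
that the search for n_F^(m) terminates and that the total mass of F_m is at least
(1 - epsF)^m in every row. Summing against the nonnegative weights gamma_k^(m) and
v^(m) D_k turns this into the two inequalities of step 1. *)
Require Import Defs.
From mathcomp Require Import all_boot all_order all_algebra.
From mathcomp Require Import all_classical all_reals all_analysis.

Set Implicit Arguments.
Unset Strict Implicit.
Unset Printing Implicit Defensive.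

Import Order.TTheory GRing.Theory Num.Theory.
Local Open Scope ring_scope.

Lemma first_natP (Q : pred nat) : (exists n, Q n) -> Q (first_nat Q).
Proof. by rewrite /first_nat; case: pselect => // exQ _; case: ex_minnP. Qed.

(** * Sums over multi-indices of bounded size *)

Section MultiSum.
Context (R : realType) (K : nat).
Implicit Types (a n : multi K) (N : nat).

Lemma mabs_munit (k : 'I_K) l : mabs (munit k l) = l.
Proof.
rewrite /mabs (bigD1 k) //= ffunE eqxx big1 ?addn0 // => j jk.
by rewrite ffunE (negbTE jk).
Qed.

Lemma mabs_multi0 : mabs (multi0 K) = 0%N.
Proof. by rewrite /mabs big1 // => j _; rewrite ffunE. Qed.

Lemma leq_mabs n (k : 'I_K) : (n k <= mabs n)%N.
Proof. by rewrite /mabs (bigD1 k) //= leq_addr. Qed.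

Lemma msub0 n : msub n (multi0 K) = n.
Proof. by apply/ffunP => j; rewrite !ffunE subn0. Qed.

Lemma mabs_eq0 n : (mabs n == 0%N) = (n == multi0 K).
Proof.
apply/idP/eqP => [|->]; last by rewrite mabs_multi0.
rewrite sum_nat_eq0 => /forall_inP n0; apply/ffunP => j.
by rewrite ffunE; apply/eqP/n0.
Qed.

Lemma ustep_subz N N' : ustep R (N%:Z - N'%:Z) = (N' <= N)%:R.
Proof. by rewrite /ustep subr_ge0 lez_nat; case: leqP. Qed.

(** Translation by [a] is a bijection from the indices of size at most [N] onto the indices kept by
    the condition. The bound on [N'] ensures that no translated index falls outside the larger
    range. *)
Lemma multi_sum_shift (p r : nat) N N' a (X : multi K -> 'M[R]_(p, r)) :
  (mabs a + N <= N')%N ->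
  multi_sum N' (fun n => if [forall j, a j <= n j]%N && (mabs (msub n a) <= N)%N
                         then X (msub n a) else 0)
  = multi_sum N X.
Proof.
move=> aN; rewrite /multi_sum -big_mkcondr /=.
(* [up] always stays in range, since [f j <= N] and [a j <= mabs a]. [down] may meet the default
   value of [inord] or a subtraction truncated at 0, but never on the indices kept by the
   condition. *)
pose up (f : {ffun 'I_K -> 'I_N.+1}) : {ffun 'I_K -> 'I_N'.+1} :=
  [ffun j => inord (f j + a j)].
pose down (f : {ffun 'I_K -> 'I_N'.+1}) : {ffun 'I_K -> 'I_N.+1} :=
  [ffun j => inord (f j - a j)].
have upE f j : up f j = (f j + a j)%N :> nat.
  rewrite ffunE inordK // ltnS (leq_trans _ aN) // addnC leq_add ?leq_mabs //.
  by rewrite -ltnS.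
rewrite (reindex_onto up down) /=; last first.
  move=> f /and3P[_ /forallP af fN]; apply/ffunP => j; apply/val_inj.
  rewrite /= upE [down f j]ffunE inordK; last first.
    rewrite ltnS; apply: leq_trans fN.
    by apply: leq_trans (leq_mabs _ j); rewrite !ffunE.
  by rewrite subnK //; have := af j; rewrite ffunE.
have msubE f : msub [ffun k => up f k : nat] a = [ffun k => f k : nat].
  by apply/ffunP => j; rewrite [LHS]ffunE [X in (X - _)%N]ffunE upE addnK ffunE.
apply: eq_big => [f|f _]; last by rewrite msubE.
rewrite msubE.
have -> : down (up f) == f.
  apply/eqP/ffunP => j; apply/val_inj.
  by rewrite /= ffunE upE addnK inordK.
have -> : [forall j, a j <= [ffun k => up f k : nat] j]%N.
  by apply/forallP => j; rewrite ffunE upE leq_addl.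
have -> : mabs [ffun k => f k : nat] = (\sum_k f k)%N.
  by apply: eq_bigr => j _; rewrite ffunE.
rewrite andbT /=.
case: (leqP (\sum_k f k)%N N) => fN; last by rewrite andbF.
rewrite andbT; under eq_bigr => j _ do rewrite upE.
by rewrite big_split /= addnC (leq_trans _ aN) // leq_add2l.
Qed.

Lemma multi_sum_ustep (p r : nat) N N' (X : multi K -> 'M[R]_(p, r)) :
  (N <= N')%N ->
  multi_sum N' (fun n => ustep R (N%:Z - (mabs n)%:Z) *: X n) = multi_sum N X.
Proof.
move=> NN'; rewrite -(@multi_sum_shift _ _ N N' (multi0 K)) ?mabs_multi0 //.
apply: eq_bigr => f _; rewrite msub0 ustep_subz.
have -> /= : [forall j, multi0 K j <= [ffun k => f k : nat] j]%N.
  by apply/forallP => j; rewrite [multi0 K j]ffunE.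
by case: leqP; rewrite ?scale1r ?scale0r.
Qed.

Lemma multi_sum_mulmxr (p r s : nat) N (X : multi K -> 'M[R]_(p, r))
    (B : 'M[R]_(r, s)) :
  multi_sum N (fun n => X n *m B) = multi_sum N X *m B.
Proof. by rewrite /multi_sum mulmx_suml. Qed.

Lemma multi_sum_mulmxl (p r s : nat) N (X : multi K -> 'M[R]_(p, r))
    (B : 'M[R]_(s, p)) :
  multi_sum N (fun n => B *m X n) = B *m multi_sum N X.
Proof. by rewrite /multi_sum mulmx_sumr. Qed.

End MultiSum.

(** * One convolution step acts on the total mass as a matrix product *)

Section Step.
Context (R : realType) (K M : nat) (q : queue R K M) (c : choices R K).

Local Notation th := (theta q).

(** The uniformized transition matrix of the underlying chain, except that class [k] batches larger
    than [ng c k] are dropped. *)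
Definition truncated_step : 'M[R]_M :=
  1%:M + th^-1 *: matC q
  + th^-1 *: \sum_k \sum_(1 <= l < (ng c k).+1) gB q k l *: matD q k.

(** Once the sum over indices is moved inside, each batch term is a translate of [F] by [munit k l],
    so [multi_sum_shift] applies. Since [l <= ng c k], the range [N'] captures every translate
    completely. *)
Lemma multi_sum_Fstep N N' (F : multi K -> 'M[R]_M) :
  (forall k, N + ng c k <= N')%N -> (N <= N')%N ->
  multi_sum N' (Fstep q c N F) = multi_sum N F *m truncated_step.
Proof.
move=> ngN NN'; rewrite /truncated_step mulmxDr -multi_sum_mulmxr.
rewrite -(multi_sum_ustep _ NN') /multi_sum /Fstep big_split /=; congr (_ + _).
rewrite -scaler_sumr -scalemxAr; congr (_ *: _).
rewrite exchange_big /= mulmx_sumr; apply: eq_bigr => k _.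
(* The upper bound on [l] depends on the index; widening it to [ng c k] and moving the constraint
   into a conditional lets the two sums be exchanged. *)
under eq_bigr => f _.
  rewrite (big_nat_widen _ _ (ng c k).+1) ?ltnS ?geq_minr // big_mkcondr /=.
  over.
rewrite exchange_big /= mulmx_sumr; apply: eq_big_nat => l /andP[l1 lng].
rewrite -/(multi_sum N F) -multi_sum_mulmxr.
rewrite -(@multi_sum_shift _ _ _ _ N N' (munit k l)); last first.
  by rewrite mabs_munit addnC (leq_trans _ (ngN k)) // leq_add2l.
apply: eq_bigr => f _; rewrite ustep_subz.
(* As [l <= ng c k] already holds, the constraint left by the minimum says exactly that the
   subtraction of [munit k l] is not truncated. *)
have -> : [forall j, munit k l j <= [ffun k => f k : nat] j]%N
    = (l < (minn ([ffun k => f k : nat] k) (ng c k)).+1)%N.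
  rewrite ltnS leq_min -[X in _ && X]ltnS lng andbT.
  apply/forallP/idP => [/(_ k)|lf j]; rewrite ?[munit _ _ _]ffunE ?eqxx //.
  by case: eqP => // ->.
by case: ifP => //= _; case: leqP; rewrite ?scale1r ?scale0r.
Qed.

Lemma msub_munit_eq0 (n : multi K) (k : 'I_K) l :
  (l <= n k)%N -> (msub n (munit k l) == multi0 K) = (n == munit k l).
Proof.
move=> ln; apply/eqP/eqP => [/ffunP n0|->]; last first.
  by apply/ffunP => j; rewrite !ffunE subnn.
apply/ffunP => j; have := n0 j; rewrite !ffunE.
case: eqP => [->|_]; last by rewrite subn0.
by move=> /eqP; rewrite subn_eq0 => nl; apply/eqP; rewrite eqn_leq nl ln.
Qed.

(** The explicit initialisation at m = 1 is thereby an ordinary convolution step, so the later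
    inductions can treat it like the others. With cut-off 0, a batch term survives only when the
    index equals [munit k l]. *)
Lemma Fstep0_F0 : Fstep q c 0 (@F0 R K M) =1 F1 q c.
Proof.
move=> n; rewrite /Fstep /F1 ustep_subz leqn0 mabs_eq0 {1}/F0.
case: (eqVneq n (multi0 K)) => [->|n0].
  rewrite scale1r mul1mx big1 ?scaler0 ?addr0 // => k _.
  by rewrite ffunE min0n big_nil.
rewrite scale0r add0r.
have termE k l : (l <= n k)%N ->
    ustep R (0%N%:Z - (mabs (msub n (munit k l)))%:Z) *:
      ((@F0 R K M (msub n (munit k l))) *m (gB q k l *: matD q k))
    = if n == munit k l then gB q k l *: matD q k else 0.
  move=> ln; rewrite ustep_subz leqn0 mabs_eq0 /F0 msub_munit_eq0 //.
  by case: ifP; rewrite ?scale0r ?scale1r ?mul1mx.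
have munit_k k l : n = munit k l -> l = n k by move=> ->; rewrite ffunE eqxx.
(* If no class is picked, a surviving term would itself supply one. If [k] is picked, the other
   components of [n] vanish, so the other classes have empty sums, and only the last term [l = n k]
   of class [k] remains. *)
case: pickP => [k /andP[/eqP nk nng]|nopick]; last first.
  rewrite big1 ?scaler0 // => k _; rewrite big_nat big1 // => l /andP[_].
  rewrite ltnS leq_min => /andP[ln lng]; rewrite termE //.
  case: eqP => // nk; have := nopick k.
  by rewrite -(munit_k _ _ nk) -nk eqxx lng.
have nk_gt0 : (0 < n k)%N.
  rewrite lt0n; apply: contraNneq n0 => nk0; rewrite nk nk0.
  by apply/eqP/ffunP => j; rewrite !ffunE if_same.
rewrite (bigD1 k) //= [X in _ + X]big1 ?addr0; last first.
  move=> j jk; rewrite (_ : n j = 0%N) ?min0n ?big_nil //.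
  by rewrite nk ffunE (negbTE jk).
congr (_ *: _); rewrite (minn_idPl nng) big_nat_recr //= termE // -nk eqxx.
rewrite big_nat big1 ?add0r // => l /andP[_ ln].
rewrite termE 1?ltnW //; case: eqP => // /munit_k lE.
by rewrite lE ltnn in ln.
Qed.

End Step.

(** * Nonnegative matrices and the generator of the underlying chain *)

Lemma mxOver_nnegD (R : realType) (m n : nat) (A B : 'M[R]_(m, n)) :
  A \is a mxOver Num.nneg -> B \is a mxOver Num.nneg ->
  A + B \is a mxOver Num.nneg.
Proof.
move=> /mxOverP A0 /mxOverP B0; apply/mxOverP => i j.
by rewrite mxE rpredD ?A0 ?B0.
Qed.

Lemma mxOver_nneg_sum (R : realType) (m n : nat) (I : Type) (r : seq I)
    (Q : pred I) (F : I -> 'M[R]_(m, n)) :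
  (forall i, Q i -> F i \is a mxOver Num.nneg) ->
  \sum_(i <- r | Q i) F i \is a mxOver Num.nneg.
Proof.
move=> F0; elim/big_rec: _ => [|i A Qi A0]; first by rewrite mxOver0 ?nnegrE.
by rewrite mxOver_nnegD ?F0.
Qed.

Section Generator.
Context (R : realType) (K M : nat) (q : queue R K M) (pi : 'rV[R]_M).
Hypothesis hq : queue_assumptions q pi.

Local Notation th := (theta q).

Lemma matDn_ge0 k n i j : (1 <= n)%N -> 0 <= matDn q k n i j.
Proof.
by move=> n1; rewrite mxE mulr_ge0 ?(sigma_ge0 hq) // ltW ?(mu_gt0 hq).
Qed.

Lemma matD_nneg k : matD q k \is a mxOver Num.nneg.
Proof.
apply/mxOverP => i j; rewrite nnegrE mxE fine_ge0 //.
by apply: nneseries_ge0 => n n1 _; rewrite lee_fin matDn_ge0.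
Qed.

(** The phase-type assumption identifies this product with [matDn q k l], whose entries are rates;
    no analysis of the powers of [phP] is required. *)
Lemma gB_matD_nneg k l :
  (1 <= l)%N -> gB q k l *: matD q k \is a mxOver Num.nneg.
Proof.
move=> l1; rewrite -(batch_phase_type hq) //.
by apply/mxOverP => i j; rewrite nnegrE matDn_ge0.
Qed.

Lemma mu_le_theta i : mu q i <= th.
Proof.
by apply: le_trans (le_bigmax _ _ i); rewrite mxE eqxx normrN ler_norm.
Qed.

Lemma theta_ge0 : 0 <= th.
Proof. exact: bigmax_ge_id. Qed.

Lemma theta_gt0 (i : 'I_M) : 0 < th.
Proof. exact: lt_le_trans (mu_gt0 hq i) (mu_le_theta i). Qed.

(** Only the diagonal could be negative, and there [theta] dominates every [mu q i]. *)
Lemma uniformized_nneg : 1%:M + th^-1 *: matC q \is a mxOver Num.nneg.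
Proof.
apply/mxOverP => i j; rewrite nnegrE !mxE.
case: eqVneq => [->|ij] /=.
  rewrite mulrN subr_ge0 mulrC ler_pdivrMr ?(theta_gt0 j) //.
  by rewrite mul1r mu_le_theta.
rewrite add0r mulr_ge0 ?invr_ge0 ?theta_ge0 // mulr_ge0 ?(sigma0_ge0 hq) //.
by rewrite ltW ?(mu_gt0 hq).
Qed.

Local Notation arrival_prob k i j :=
  (\sum_(1 <= n <oo) (sigma q k i j n)%:E)%E.

Lemma arrival_prob_ge0 k i j : (0 <= arrival_prob k i j)%E.
Proof.
by apply: nneseries_ge0 => n n1 _; rewrite lee_fin (sigma_ge0 hq).
Qed.

(** This series is one nonnegative part of a total equal to 1. Finiteness matters because [fine]
    sends an infinite value to 0. *)
Lemma arrival_prob_fin_num k i j : arrival_prob k i j \is a fin_num.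
Proof.
rewrite ge0_fin_numE ?arrival_prob_ge0 //.
apply: le_lt_trans (ltry 1); rewrite -(sigma_total hq i).
have row_ge0 k' : (0 <= \sum_j arrival_prob k' i j)%E.
  by apply: sume_ge0 => j' _; exact: arrival_prob_ge0.
apply: (@le_trans _ _ (\sum_k \sum_j arrival_prob k i j)%E).
  rewrite (bigD1 k) //= (bigD1 j) //= -addeA leeDl // adde_ge0 ?sume_ge0 //.
  by move=> j' _; exact: arrival_prob_ge0.
by rewrite leeDr // sume_ge0 // => j' _; rewrite lee_fin (sigma0_ge0 hq).
Qed.

Lemma matDE k i j : matD q k i j = mu q i * fine (arrival_prob k i j).
Proof.
rewrite mxE eseries_cond; under eq_eseriesr do rewrite mxE mulrC EFinM.
rewrite nneseriesZl -?eseries_cond; first by rewrite fineM ?arrival_prob_fin_num.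
by move=> n; rewrite !andTb => n1; rewrite lee_fin (sigma_ge0 hq).
Qed.

(** Row [i] sums to [mu q i] times the total transition probability minus 1, which vanishes by
    [sigma_total]. *)
Lemma generator_ones : (matC q + matDtot q) *m ones R = 0 :> 'cV_M.
Proof.
apply/colP => i; rewrite mulmxDl !mxE.
have -> : \sum_j matC q i j * (ones R) j 0
    = mu q i * (\sum_j sigma0 q i j - 1).
  rewrite (bigD1 i) //= [in RHS](bigD1 i) //= (sigma0_diag hq) add0r.
  rewrite !mxE eqxx mulr1 addrC mulrBr mulr1 mulr_sumr; congr (_ - _).
  by apply: eq_bigr => j ji; rewrite !mxE eq_sym (negbTE ji) mulr1 mulrC.
have -> : \sum_j matDtot q i j * (ones R) j 0
    = mu q i * \sum_k \sum_j fine (arrival_prob k i j).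
  rewrite mulr_sumr.
  under eq_bigr do rewrite mxE mulr1 summxE.
  rewrite exchange_big /=; apply: eq_bigr => k _; rewrite mulr_sumr.
  by apply: eq_bigr => j _; rewrite matDE.
have := sigma_total hq i.
have -> : (\sum_k \sum_j arrival_prob k i j)%E
    = (\sum_k \sum_j fine (arrival_prob k i j))%:E.
  rewrite -sumEFin; apply: eq_bigr => k _; rewrite -sumEFin.
  by apply: eq_bigr => j _; rewrite fineK ?arrival_prob_fin_num.
rewrite sumEFin -EFinD => -[total].
by rewrite -mulrDr addrAC total subrr mulr0.
Qed.

Lemma poisson_weight_ge0 m x : 0 <= x -> 0 <= poisson_weight q m x.
Proof.
move=> x0; rewrite mulr_ge0 ?expR_ge0 // divr_ge0 // exprn_ge0 //.
by rewrite mulr_ge0 ?theta_ge0.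
Qed.

Lemma gammam_ge0 k m : 0 <= gammam q k m.
Proof.
rewrite fine_ge0 // integral_ge0 //= => x; rewrite in_itv /= andbT => x0.
by rewrite lee_fin poisson_weight_ge0.
Qed.

Lemma vm_nneg (v : 'I_M -> {finite_measure set (measurableTypeR R) -> \bar R}) m :
  vm q v m \is a mxOver Num.nneg.
Proof.
apply/mxOverP => i j; rewrite nnegrE mxE fine_ge0 // integral_ge0 //= => x.
by rewrite in_itv /= andbT => x0; rewrite lee_fin poisson_weight_ge0.
Qed.

End Generator.

Lemma mulmx_ones_ge (R : realType) (p n : nat) (A : 'M[R]_(p, n)) (x : 'cV[R]_n)
    (b : R) i :
  A \is a mxOver Num.nneg -> (forall j, b <= x j 0) ->
  b * (A *m ones R) i 0 <= (A *m x) i 0.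
Proof.
move=> /mxOverP A0 bx; rewrite !mxE mulr_sumr; apply: ler_sum => j _.
by rewrite mxE mulr1 mulrC ler_wpM2l // -nnegrE.
Qed.

(** * Lower bound on the truncated mass, and termination of the search *)

Section Invariant.
Context (R : realType) (K M : nat) (q : queue R K M) (pi : 'rV[R]_M).
Context (c : choices R K).
Hypotheses (hq : queue_assumptions q pi) (K_gt0 : (1 <= K)%N).
Hypotheses (epsF01 : 0 < epsF c < 1) (h2 : step2 q c).

Local Notation th := (theta q).

(** By [generator_ones] the untruncated matrix has unit row sums, and step 2 bounds the loss caused
    by each class by [epsg c / K]. *)
Lemma truncated_step_ones i : 1 - epsg c <= (truncated_step q c *m ones R) i 0.
Proof.
have [_ _ ngP] := h2.
have -> : (truncated_step q c *m ones R) i 0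
    = 1 + (th^-1 *: (matC q *m ones R)) i 0
      + \sum_k (th^-1 *: \sum_(1 <= n < (ng c k).+1)
                 (gB q k n *: matD q k *m ones R)) i 0.
  rewrite /truncated_step !mulmxDl mul1mx -!scalemxAl.
  rewrite mxE [X in X + _]mxE [X in X + _ + _]mxE; congr (_ + _).
  rewrite mxE mulmx_suml summxE mulr_sumr; apply: eq_bigr => k _.
  by rewrite mulmx_suml mxE.
have genP : (th^-1 *: (matC q *m ones R)) i 0
    = - \sum_k (th^-1 *: (matD q k *m ones R)) i 0.
  rewrite -summxE -scaler_sumr -mulmx_suml -/(matDtot q).
  have -> : matC q *m ones R = - (matDtot q *m ones R) :> 'cV_M.
    by apply/eqP; rewrite -addr_eq0 -mulmxDl (generator_ones hq).
  by rewrite scalerN mxE.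
rewrite genP -addrA lerD2l addrC -sumrB.
(* The allowed loss is split evenly among the classes, which uses K > 0. *)
have -> : - epsg c = \sum_(k < K) (- (epsg c / K%:R)).
  rewrite sumrN sumr_const card_ord -[(_ / _) *+ _]mulr_natr divfK //.
  by rewrite pnatr_eq0 -lt0n.
apply: ler_sum => k _; rewrite lerBrDl ltW //.
have /forallP/(_ i)/forallP/(_ 0) := ngP k.
by rewrite !mxE mulr1.
Qed.

Lemma multi_sum_nneg N (F : multi K -> 'M[R]_M) :
  (forall n, F n \is a mxOver Num.nneg) ->
  multi_sum N F \is a mxOver Num.nneg.
Proof. by move=> F0; apply: mxOver_nneg_sum => f _. Qed.

Lemma ustep_ge0 (x : int) : 0 <= ustep R x.
Proof. by rewrite /ustep; case: ifP. Qed.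

Lemma Fstep_nneg N (F : multi K -> 'M[R]_M) :
  (forall n, F n \is a mxOver Num.nneg) ->
  forall n, Fstep q c N F n \is a mxOver Num.nneg.
Proof.
move=> F0 n; apply: mxOver_nnegD.
  by rewrite mxOverZ ?nnegrE ?ustep_ge0 // mxOverM // (uniformized_nneg hq).
rewrite mxOverZ ?nnegrE ?invr_ge0 ?(theta_ge0 q) //.
apply: mxOver_nneg_sum => k _; rewrite big_nat.
apply: mxOver_nneg_sum => l /andP[l1 _].
by rewrite mxOverZ ?nnegrE ?ustep_ge0 // mxOverM // (gB_matD_nneg hq).
Qed.

(** The gap between [epsg c] and [epsF c], with [b] positive, makes the inequality strict, as the
    search criterion demands. *)
Lemma truncated_step_gt N (F : multi K -> 'M[R]_M) b :
  0 < b -> (forall n, F n \is a mxOver Num.nneg) ->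
  (forall i, b <= (multi_sum N F *m ones R) i 0) ->
  forall i, (1 - epsF c) * b < (multi_sum N F *m truncated_step q c *m ones R) i 0.
Proof.
move=> b0 F0 bF i; have [/andP[_ gF] _ _] := h2; have /andP[_ F1] := epsF01.
rewrite -mulmxA.
apply: lt_le_trans (mulmx_ones_ge i (multi_sum_nneg N F0) truncated_step_ones).
apply: (@lt_le_trans _ _ ((1 - epsg c) * b)).
  by rewrite ltr_pM2r // ltrD2l ltrN2.
by rewrite ler_pM2l // subr_gt0 (lt_trans gF).
Qed.

Lemma multi_sum_F0 : multi_sum 0 (@F0 R K M) = 1%:M.
Proof.
rewrite /multi_sum (bigD1 [ffun=> ord0]) /=; last first.
  by rewrite big1 // => j _; rewrite ffunE.
rewrite big1 ?addr0 => [|f /andP[_ /eqP[]]]; last first.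
  by apply/ffunP => j; rewrite (ord1 (f j)) ord1.
by rewrite /F0 ifT //; apply/eqP/ffunP => j; rewrite !ffunE.
Qed.

Lemma Fbreve_nneg m n : Fbreve q c m n \is a mxOver Num.nneg.
Proof.
rewrite /Fbreve; elim: m n => [|[|m] IH] n.
- rewrite /= /F0; case: ifP => _; last by rewrite mxOver0 ?nnegrE.
  by rewrite mxOver_scalar ?nnegrE.
- by rewrite /= -Fstep0_F0; apply: Fstep_nneg => n'; exact: (IH n').
- exact: Fstep_nneg.
Qed.

(** The bound is not strict because it is an equality at m = 0. From m = 2 on, it comes from the
    stopping criterion once the search is known to succeed. *)
Lemma multi_sum_Fbreve m i :
  (1 - epsF c) ^+ m <= (multi_sum (nF q c m) (Fbreve q c m) *m ones R) i 0.
Proof.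
have b_gt0 p : 0 < (1 - epsF c) ^+ p.
  by rewrite exprn_gt0 // subr_gt0; case/andP: epsF01.
elim: m i => [|[|m] IH] i.
- by rewrite multi_sum_F0 mul1mx mxE.
- have -> : multi_sum (nF q c 1) (Fbreve q c 1)
      = multi_sum (nF q c 0) (Fbreve q c 0) *m truncated_step q c.
    rewrite -(@multi_sum_Fstep _ _ _ _ _ _ (nF q c 1)) //.
      by apply: eq_bigr => f _; rewrite Fstep0_F0.
    by move=> k; rewrite add0n leq_bigmax.
  by rewrite exprS ltW // truncated_step_gt // => n; exact: Fbreve_nneg.
- set N := nF q c m.+1; set F := Fbreve q c m.+1.
  pose Q N' := mxlt ((1 - epsF c) ^+ m.+2 *: ones R)
                    (multi_sum N' (fun n => Fstep q c N F n *m ones R)).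
  have : Q (nF q c m.+2).
    (* At this size all the mass of the step is collected, so the criterion holds and the default
       value of [first_nat] is excluded. *)
    apply: (@first_natP Q); exists (N + \max_k ng c k)%N.
    apply/forallP => i'; apply/forallP => j; rewrite (ord1 j).
    rewrite multi_sum_mulmxr multi_sum_Fstep ?leq_addr //; last first.
      by move=> k; rewrite leq_add2l leq_bigmax.
    rewrite !mxE mulr1 exprS.
    have := @truncated_step_gt N F _ (b_gt0 m.+1) (Fbreve_nneg _) IH i'.
    by rewrite mxE.
  move=> /forallP/(_ i)/forallP/(_ 0).
  by rewrite multi_sum_mulmxr [X in X < _]mxE mxE mulr1 => /ltW.
Qed.

End Invariant.

(** * Total mass of the outputs and the final estimates *)

Section Output.
Context (R : realType) (K M : nat) (q : queue R K M) (c : choices R K).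
Context (v : 'I_M -> {finite_measure set (measurableTypeR R) -> \bar R}).

(** Since [nA] is at least every [nF q c m] involved, the step function alone decides the range of
    summation for each [m]. *)
Lemma multi_sum_Abreve k :
  multi_sum (nA q c k) (Abreve q c k)
  = \sum_(0 <= m < (mgamma c k).+1)
      gammam q k m *: multi_sum (nF q c m) (Fbreve q c m).
Proof.
rewrite {1}/multi_sum exchange_big; apply: eq_big_nat => m mk /=.
rewrite -(@multi_sum_ustep _ _ _ _ _ (nA q c k)); last first.
  by rewrite /nA (leq_bigmax_seq m) ?mem_index_iota.
by rewrite /multi_sum scaler_sumr; apply: eq_bigr => f _; rewrite scalerA mulrC.
Qed.

Lemma multi_sum_vbreve k :
  multi_sum (nv q c k) (vbreve q v c k)
  = \sum_(0 <= m < (mv c k).+1)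
      vm q v m *m matD q k *m multi_sum (nF q c m) (Fbreve q c m).
Proof.
rewrite {1}/multi_sum exchange_big; apply: eq_big_nat => m mk /=.
rewrite -multi_sum_mulmxl -(@multi_sum_ustep _ _ _ _ _ (nv q c k)) //.
by rewrite /nv (leq_bigmax_seq m) ?mem_index_iota.
Qed.

End Output.

Theorem theoremV1 (R : realType) (K M : nat) (hK : (1 <= K)%N) (hM : (1 <= M)%N)
    (q : queue R K M) (pi : 'rV[R]_M) (hq : queue_assumptions q pi)
    (d : measure_display) (Omega : measurableType d) (P : probability Omega R)
    (w : driving R K M Omega) (hw : driving_law q P w)
    (v : 'I_M -> {finite_measure set (measurableTypeR R) -> \bar R})
    (hv : stationary_law P w v) (hvbar : vbar1_finite v)
    (eps : R) (heps : 0 < eps < 1)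
    (c : choices R K) (h1 : step1 q pi v eps c) (h2 : step2 q c) (k : 'I_K) :
  mxlt ((1 - eps) *: ones R)
       (multi_sum (nA q c k) (fun n => Abreve q c k n *m ones R))
  /\ (1 - eps) * lambdaB q pi k
     < multi_sum (nv q c k) (fun n => vbreve q v c k n *m ones R) 0 0.
Proof.
have [epsF01 _ gammaP vP] := h1.
have FbreveP := multi_sum_Fbreve hq hK epsF01 h2.
split.
  apply/forallP => i; apply/forallP => j; rewrite (ord1 j).
  rewrite multi_sum_mulmxr multi_sum_Abreve mulmx_suml summxE [ltLHS]mxE mxE mulr1.
  apply: lt_le_trans (gammaP k) _; apply: ler_sum => m _.
  by rewrite -scalemxAl [leRHS]mxE ler_wpM2l ?(gammam_ge0 q) // FbreveP.
rewrite multi_sum_mulmxr multi_sum_vbreve mulmx_suml summxE.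
apply: lt_le_trans (vP k) _; apply: ler_sum => m _.
(* Grouping the product this way leaves the nonnegative row [vm q v m *m matD q k] acting on a
   column bounded below by [(1 - epsF c) ^+ m]. *)
rewrite -[(_ *m multi_sum _ _) *m _]mulmxA mulrC mulmx_ones_ge //.
by rewrite mxOverM ?(matD_nneg hq) ?vm_nneg.
Qed.
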